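(* For every integer $m>0$ there exists a polynomial $R_m(x,t)\in\mathbb{Z}[x,t]$ such that, as formal power series in $x$, $$D_m(x,t)=\frac{R_m(x,t)}{\prod_{j=0}^{\lfloor m/2\rfloor}A_{m-2j}(x,t)^{\binom{m}{j}}}.$$
   Context: Let $t$ be an indeterminate. A Motzkin path from $(0,0)$ to $(n,0)$ is a lattice path with up-steps $(1,1)$, down-steps $(1,-1)$ and horizontal steps $(1,0)$ which never runs below the $x$-axis. The weight of a path is the product of the weights of its steps, where horizontal steps have weight $t$ and up-steps and down-steps have weight $1$. For $n\ge 0$ the Motzkin polynomial $M_n(t)$ is the sum of the weights of all Motzkin paths from $(0,0)$ to $(n,0)$; equivalently, $$M_n(t)=\sum_{j=0}^{\lfloor n/2\rfloor}\binom{n}{2j}C_j\,t^{n-2j},\qquad C_j=\frac{1}{j+1}\binom{2j}{j}.$$ For integers $m\ge 0$ and $n\ge 1$ define the Hankel determinants $d_m(n,t)=\det\left(M_{m+i+j}(t)\right)_{i,j=0}^{n-1}$, and set $d_m(0,t)=1$. Their generating function is the formal power series $$D_m(x,t)=\sum_{n\ge 0}d_m(n,t)\,x^n .$$ The Lucas polynomials $L_n(t)$ are defined by $L_n(t)=tL_{n-1}(t)-L_{n-2}(t)$ for $n\ge 2$, with $L_0(t)=2$ and $L_1(t)=t$. Define $$A_n(x,t)=x^2-L_n(t)\,x+1\quad\text{for } n>0,\qquad A_0(x,t)=1-x .$$ *)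

(* Defs.v *)
From HB Require Import structures.
From mathcomp Require Import all_boot all_order all_algebra.

Set Implicit Arguments.
Unset Strict Implicit.
Unset Printing Implicit Defensive.

Import Order.TTheory GRing.Theory Num.Theory.
Local Open Scope ring_scope.

(* Z[t] is {poly int}, and Z[x,t] is {poly {poly int}}: the outer indeterminate
   is x, the inner one is t.  So 'X is t in {poly int} and x in
   {poly {poly int}}. *)

Inductive step := Up | Down | Level.

Definition step_code (a : step) : option bool :=
  match a with Up => Some true | Down => Some false | Level => None end.

Definition step_decode (o : option bool) : step :=
  match o with Some true => Up | Some false => Down | None => Level end.

Lemma step_codeK : cancel step_code step_decode.
Proof. by case. Qed.

HB.instance Definition _ := Equality.copy step (can_type step_codeK).
HB.instance Definition _ := Choice.copy step (can_type step_codeK).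
HB.instance Definition _ := Countable.copy step (can_type step_codeK).
HB.instance Definition _ : isFinite step := CanIsFinite step_codeK.

Definition rise (a : step) : int :=
  match a with Up => 1 | Down => -1 | Level => 0 end.

Definition height (s : seq step) : int := \sum_(a <- s) rise a.

Definition motzkin_path (n : nat) (s : n.-tuple step) : bool :=
  [forall k : 'I_n.+1, 0 <= height (take k s)] && (height s == 0).

Definition weight (a : step) : {poly int} :=
  match a with Up | Down => 1 | Level => 'X end.

Definition motzkin (n : nat) : {poly int} :=
  \sum_(s : n.-tuple step | motzkin_path s) \prod_(a <- s) weight a.

Definition hankel_det (m n : nat) : {poly int} :=
  \det (\matrix_(i < n, j < n) motzkin (m + i + j)).

Lemma hankel_det0 m : hankel_det m 0 = 1.
Proof. exact: det_mx00. Qed.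

Fixpoint lucas (n : nat) : {poly int} :=
  match n with
  | 0 => 2%:R
  | 1 => 'X
  | (n'.+1 as n1).+1 => 'X * lucas n1 - lucas n'
  end.

Definition A (n : nat) : {poly {poly int}} :=
  if n == 0%N then 1 - 'X else 'X^2 - (lucas n)%:P * 'X + 1.

(* A formal power series is its sequence of coefficients; equality of series
   is pointwise equality (=1). *)
Definition fps (R : Type) : Type := nat -> R.

Definition hankel_gf (m : nat) : fps {poly int} := fun n => hankel_det m n.

Definition fps_poly (R : nzRingType) (p : {poly R}) : fps R := fun n => p`_n.

Definition fps_mul (R : nzRingType) (f g : fps R) : fps R :=
  fun n => \sum_(i < n.+1) f i * g (n - i)%N.

(* First n coefficients of the inverse of f, from
   f_0 g_k = [k = 0] - \sum_(i < k) f_(k-i) g_i. *)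
Fixpoint fps_inv_prefix (R : comUnitRingType) (f : fps R) (n : nat) : seq R :=
  if n is k.+1 then
    let s := fps_inv_prefix f k in
    rcons s ((f 0%N)^-1 * ((k == 0%N)%:R - \sum_(i < k) f (k - i)%N * s`_i))
  else [::].

(* Meaningful only when the constant coefficient f 0 is a unit (fps_mulfV). *)
Definition fps_inv (R : comUnitRingType) (f : fps R) : fps R :=
  fun n => (fps_inv_prefix f n.+1)`_n.

Definition fps_div (R : comUnitRingType) (f g : fps R) : fps R :=
  fps_mul f (fps_inv g).

Lemma size_fps_inv_prefix (R : comUnitRingType) (f : fps R) n :
  size (fps_inv_prefix f n) = n.
Proof. by elim: n => //= n IH; rewrite size_rcons IH. Qed.

Lemma nth_fps_inv_prefix (R : comUnitRingType) (f : fps R) n i :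
  (i < n)%N -> (fps_inv_prefix f n)`_i = fps_inv f i.
Proof.
elim: n => // n IH; rewrite ltnS leq_eqVlt => /orP[/eqP -> //|lt_in] /=.
by rewrite nth_rcons size_fps_inv_prefix lt_in IH.
Qed.

Lemma fps_mulfV (R : comUnitRingType) (f : fps R) :
  f 0%N \is a GRing.unit ->
  fps_mul f (fps_inv f) =1 fps_poly 1.
Proof.
move=> Uf n; rewrite /fps_mul /fps_poly coef1 (reindex_inj rev_ord_inj) /=.
rewrite big_ord_recr /= !subSS subnn subn0 {2}/fps_inv /= nth_rcons.
rewrite size_fps_inv_prefix ltnn eqxx mulVKr // addrC.
rewrite [X in _ + X](_ : _ = \sum_(i < n) f (n - i)%N * (fps_inv_prefix f n)`_i).
  by rewrite subrK; case: n.
apply: eq_bigr => i _; rewrite nth_fps_inv_prefix // subSS.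
by rewrite subKn // ltnW.
Qed.

Lemma denominator_coef0 m :
  (\prod_(0 <= j < m./2.+1) A (m - 2 * j) ^+ 'C(m, j))`_0 = 1.
Proof.
have A0 n : (A n).[0] = 1.
  by rewrite /A; case: eqP => _; rewrite !(hornerE, subr0, mulr0, mul0r, expr0n, oppr0, add0r).
rewrite -horner_coef0 horner_prod big1 // => j _.
by rewrite horner_exp A0 expr1n.
Qed.

(* Main.v *)
Require Import Defs.
From HB Require Import structures.
From mathcomp Require Import all_boot all_order all_algebra.
From mathcomp Require Import perm ring zify.

Set Implicit Arguments.
Unset Strict Implicit.
Unset Printing Implicit Defensive.

Import Order.TTheory GRing.Theory Num.Theory.
Local Open Scope ring_scope.

(** The Motzkin polynomials evaluated at [t] are the moments of a linear
    functional whose monic orthogonal polynomials [p_n] satisfy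
    [p_(n+2) = (X - t) p_(n+1) - p_n].  Multiplying the functional by
    [w = \prod_(i < m) (X - z_i)] turns its Hankel determinants into [H_n(w)],
    and Christoffel's formula ([christoffel]) states that [H_n(w)], times the
    Vandermonde determinant of the points [z_i], is
    [(-1)^(mn) det (p_(n+k)(z_i))_(i, k < m)].  The determinant [d_m(n, t)] is the
    case in which all points are 0.

    Write [z_i = t - q_i - 1/q_i].  Then [(- q_i)^n p_n(z_i)] is a combination of
    the sequences [q_i^(2n)] and 1 ([orth_horner]), so for distinct points the
    expansion of the determinant shows that [(\prod_i q_i)^n H_n(w)] is a
    combination of the exponential sequences with ratios
    [\prod_(i in S) q_i^2], where S runs through the subsets of the [m] indices.
    Hence multiplication of its generating function by
    [\prod_S (1 - \prod_(i in S) q_i^2 x)] leaves no term of degree [2^m] or more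
    ([fps_mul_hankel_distinct]).  This is a polynomial identity in the [q_i], as
    [(\prod_i q_i)^n H_n(w) = H_n(\prod_i q_i (X - z_i))], so it persists when
    all [q_i] equal a single [q] ([fps_mul_hankel_confluent]).

    For [t = q + 1/q] the common point is 0, so the sequence is [q^(mn) d_m(n, t)],
    and after the substitution of [x / q^m] for [x] the denominator is
    [\prod_(j <= m) (1 - q^(2j - m) x)^C(m, j)].  Pairing [j] with [m - j] and
    using [(1 - q^k x) (1 - q^(-k) x) = x^2 - L_k(t) x + 1], this is the product
    of the [A_(m - 2j)] ([map_denominator]).  So the coefficients of degree at
    least [2^m] of that product times [D_m] vanish for [t = q + 1/q] with
    [q = 2, 3, 4, ...], hence identically in [t]. *)

(** * Motzkin polynomials as moments *)

(** [path_weight t n k] is the total weight of the [n]-step nonnegative paths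
    from height [k] down to height 0, level steps having weight [t] in an
    arbitrary ring.  The recursion removes the first step. *)
Fixpoint path_weight (R : nzRingType) (t : R) (n k : nat) : R :=
  if n is n'.+1 then
    t * path_weight t n' k + path_weight t n' k.+1
    + (if k is k'.+1 then path_weight t n' k' else 0)
  else (k == 0%N)%:R.

Lemma path_weight_map (R S : nzRingType) (f : {rmorphism R -> S}) t n k :
  f (path_weight t n k) = path_weight (f t) n k.
Proof.
elim: n k => [|n IH] k /=; first by rewrite rmorph_nat.
by rewrite !rmorphD rmorphM /= !IH; case: k => [|k]; rewrite ?rmorph0 ?IH.
Qed.

Lemma path_weight_small (R : nzRingType) (t : R) n k :
  (n < k)%N -> path_weight t n k = 0.
Proof.
elim: n k => [|n IH] [|k] //= lt_nk.
by rewrite !IH ?mulr0 ?addr0 // ltnW // ltnW.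
Qed.

Lemma path_weight_diag (R : nzRingType) (t : R) n : path_weight t n n = 1.
Proof.
by elim: n => //= n IH; rewrite IH !path_weight_small ?mulr0 ?add0r // ltnW.
Qed.

(** [stays_above h s]: the path with steps [s] that starts at height [h] never
    becomes negative and ends at height 0. *)
Fixpoint stays_above (h : int) (s : seq step) : bool :=
  if s is a :: s' then (0 <= h) && stays_above (h + rise a) s' else h == 0.

Lemma stays_aboveE h s :
  stays_above h s =
    all (fun k => 0 <= h + height (take k s)) (iota 0 (size s).+1)
    && (h + height s == 0).
Proof.
elim: s h => [|a s IH] h; rewrite /height.
  by rewrite /= !big_nil addr0 andbT; case: eqP => [->|_]; rewrite ?andbF.
have -> : iota 0 (size (a :: s)).+1 = 0%N :: map (addn 1) (iota 0 (size s).+1).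
  by rewrite -iotaDl.
rewrite [LHS]/= IH; move: (iota 0 _) => ks /=.
rewrite big_nil addr0 big_cons addrA all_map -andbA; congr (_ && (_ && _)).
by apply: eq_all => k; rewrite /= /height big_cons addrA.
Qed.

Lemma motzkin_pathE n (s : n.-tuple step) : motzkin_path s = stays_above 0 s.
Proof.
rewrite /motzkin_path stays_aboveE add0r size_tuple; congr (_ && _).
apply/forallP/allP => [H k | H k].
  rewrite mem_iota add0n => /andP[_ lt_kn]; rewrite add0r.
  exact: H (Ordinal lt_kn).
by rewrite -[height _]add0r; apply: H; rewrite mem_iota ltn_ord.
Qed.

Lemma big_step (V : zmodType) (F : step -> V) :
  \sum_a F a = F Level + F Up + F Down.
Proof.
rewrite (bigD1 Level) //= (bigD1 Up) //= (bigD1 Down) //= big1 ?addr0 ?addrA //.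
by case.
Qed.

Definition cons_tuple_pair T n (p : T * n.-tuple T) : n.+1.-tuple T :=
  [tuple of p.1 :: p.2].

Lemma big_tuple_cons (V : zmodType) (T : finType) n (P : pred (n.+1.-tuple T))
    (F : n.+1.-tuple T -> V) :
  \sum_(s | P s) F s =
  \sum_a \sum_(s : n.-tuple T | P [tuple of a :: s]) F [tuple of a :: s].
Proof.
rewrite pair_big_dep /=; rewrite (reindex (@cons_tuple_pair T n)) //=.
exists (fun s : n.+1.-tuple T => (thead s, [tuple of behead s])) => [[a s] _|s _] /=.
  by congr (_, _); apply: val_inj.
by rewrite /cons_tuple_pair /= -tuple_eta.
Qed.

Lemma sum_stays_above n (h : int) :
  \sum_(s : n.-tuple step | stays_above h s) \prod_(a <- s) weight a =
  if h is Posz k then path_weight 'X n k else 0.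
Proof.
elim: n h => [|n IH] h.
  rewrite -[LHS]big_filter.
  have -> : [seq s : 0.-tuple step <- index_enum _ | stays_above h s] =
            if h == 0 then [:: [tuple]] else [::].
    have -> : index_enum (0.-tuple step : finType) = [:: [tuple]].
      apply: (@perm_small_eq (0.-tuple step)) => //; apply: uniq_perm => //.
        exact: index_enum_uniq.
      by move=> s; rewrite mem_index_enum inE tuple0 eqxx.
    by rewrite /=; case: eqP.
  by case: h => [[|k]|k] /=; rewrite ?big_seq1 ?big_nil.
rewrite big_tuple_cons /=; case: h => k; last first.
  by rewrite big1 // => a _; rewrite big_pred0.
have first_step a :
    \sum_(s : n.-tuple step | (0 <= k%:Z) && stays_above (k%:Z + rise a) s)
       \prod_(b <- a :: s) weight b =
    weight a * (if k%:Z + rise a is Posz l then path_weight 'X n l else 0).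
  rewrite -IH big_distrr /=; apply: eq_bigr => s _; by rewrite big_cons.
rewrite (eq_bigr _ (fun a _ => first_step a)) big_step /= !mul1r addn0 addn1.
by congr (_ + _); case: k {first_step} => [|k] //=; rewrite subn1.
Qed.

Lemma motzkin_path_weight n : motzkin n = path_weight 'X n 0.
Proof.
rewrite /motzkin (eq_bigl _ _ (@motzkin_pathE n)).
exact: (sum_stays_above n 0).
Qed.
(** * The moment functional and its orthogonal polynomials *)

(** The linear functional on polynomials that sends ['X^l] to [a l]. *)
Definition pairing (R : comNzRingType) (a : nat -> R) (f : {poly R}) : R :=
  \sum_(l < size f) f`_l * a l.

Lemma pairing_wide (R : comNzRingType) (a : nat -> R) (f : {poly R}) N :
  (size f <= N)%N -> pairing a f = \sum_(l < N) f`_l * a l.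
Proof.
move=> le_fN; rewrite /pairing (big_ord_widen N (fun l => f`_l * a l) le_fN).
rewrite [RHS](bigID (fun l : 'I_N => (l < size f)%N)) /=.
rewrite [X in _ + X]big1 ?addr0 // => l; rewrite -leqNgt => le_fl.
by rewrite nth_default ?mul0r.
Qed.

Lemma pairing_is_scalar (R : comNzRingType) (a : nat -> R) : scalar (pairing a).
Proof.
move=> c f g; pose N := maxn (size f) (maxn (size g) (size (c *: f + g))).
rewrite !(@pairing_wide _ a _ N) ?leq_max ?leqnn ?orbT // mulr_sumr -big_split.
by apply: eq_bigr => l _; rewrite coefD coefZ mulrDl mulrA.
Qed.

HB.instance Definition _ (R : comNzRingType) (a : nat -> R) :=
  GRing.isLinear.Build R {poly R} R _ (pairing a) (@pairing_is_scalar R a).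

Lemma pairingXn (R : comNzRingType) (a : nat -> R) n : pairing a 'X^n = a n.
Proof.
rewrite /pairing size_polyXn big_ord_recr /= coefXn eqxx mul1r big1 ?add0r //.
by move=> l _; rewrite coefXn ltn_eqF ?mul0r.
Qed.

Lemma pairing_mulX (R : comNzRingType) (a : nat -> R) (f : {poly R}) :
  pairing a ('X * f) = pairing (fun l => a l.+1) f.
Proof.
rewrite (@pairing_wide _ a _ (size f).+1); last first.
  by rewrite (leq_trans (size_polyMleq _ _)) // size_polyX.
rewrite big_ord_recl coefXM mul0r add0r; apply: eq_bigr => l _.
by rewrite coefXM.
Qed.

Lemma pairing_mulXn (R : comNzRingType) (a : nat -> R) i (f : {poly R}) :
  pairing a ('X^i * f) = pairing (fun l => a (i + l)%N) f.
Proof.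
elim: i a => [|i IH] a; first by rewrite mul1r.
rewrite exprS -mulrA pairing_mulX IH /pairing.
by apply: eq_bigr => l _; rewrite addSn.
Qed.

Lemma pairing_map (R S : comNzRingType) (f : {rmorphism R -> S}) a p :
  f (pairing a p) = pairing (fun l => f (a l)) (map_poly f p).
Proof.
rewrite [RHS](@pairing_wide _ _ _ (size p)) ?size_poly // rmorph_sum.
by apply: eq_bigr => l _; rewrite rmorphM coef_map.
Qed.

Lemma pairing_horner (R : comNzRingType) (z : R) f :
  pairing (fun l => z ^+ l) f = f.[z].
Proof. by rewrite horner_coef. Qed.

(** [moment t l] is the [l]-th Motzkin polynomial evaluated at [t]. *)
Definition moment (R : nzRingType) (t : R) (l : nat) : R := path_weight t l 0.

(** The monic orthogonal polynomials of the Motzkin moments, that is Chebyshev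
    polynomials of the second kind in [('X - t) / 2]. *)
Fixpoint orth (R : nzRingType) (t : R) (n : nat) : {poly R} :=
  match n with
  | 0 => 1
  | 1 => 'X - t%:P
  | (n'.+1 as n1).+1 => ('X - t%:P) * orth t n1 - orth t n'
  end.

Lemma two_step_ind (P : nat -> Prop) :
  P 0%N -> P 1%N -> (forall n, P n -> P n.+1 -> P n.+2) -> forall n, P n.
Proof.
move=> P0 P1 PS n; suff [] : P n /\ P n.+1 by [].
by elim: n => // n [Pn Pn1]; split=> //; apply: PS.
Qed.

Lemma orth_monic_size (R : nzRingType) (t : R) n :
  orth t n \is monic /\ size (orth t n) = n.+1.
Proof.
elim/two_step_ind: n => [||n [mn sn] [mn1 sn1]].
- by rewrite monic1 size_poly1.
- by rewrite monicXsubC size_XsubC.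
have sz : size (('X - t%:P) * orth t n.+1) = n.+3.
  by rewrite size_proper_mul ?(monicP (monicXsubC _)) ?mul1r
             ?(monicP mn1) ?oner_eq0 // size_XsubC sn1.
have lt_sz : (size (- orth t n) < size (('X - t%:P) * orth t n.+1)%R)%N.
  by rewrite size_polyN sn sz.
rewrite [orth t n.+2]/=; split; last by rewrite size_polyDl.
by rewrite monicE lead_coefDl // -monicE monicMl ?monicXsubC.
Qed.

(** The moment functional applied to ['X^i] times the [k]-th orthogonal
    polynomial is the weight of the [i]-step paths from height [k]; hence it
    vanishes for [i < k] and equals 1 for [i = k], which is orthogonality. *)
Lemma pairing_orth (R : comNzRingType) (t : R) i k :
  pairing (fun l => moment t (i + l)) (orth t k) = path_weight t i k.
Proof.
elim/two_step_ind: k i => [|| k IHk IHk1] i.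
- by rewrite -[orth t 0](expr0 'X) pairingXn addn0.
- rewrite [orth t 1]/= raddfB /= -[X in pairing _ X - _](expr1 'X) pairingXn -[t%:P]mulr1 mul_polyC.
  rewrite linearZ /= -(expr0 'X) pairingXn addn0 addn1 /moment /=.
  by rewrite addr0 addrC addKr.
have IHk1' : pairing (fun l => moment t (i + l.+1)) (orth t k.+1) =
             path_weight t i.+1 k.+1.
  by rewrite -IHk1 /pairing; apply: eq_bigr => l _; rewrite addnS.
rewrite [orth t k.+2]/= raddfB /= mulrBl raddfB /= pairing_mulX IHk1' IHk.
rewrite mul_polyC linearZ /= IHk1 /=.
by ring.
Qed.

(** * Determinants of functionals and Christoffel's formula *)

Lemma det_unitrig (R : comNzRingType) n (M : 'M[R]_n) :
  (forall i j : 'I_n, (i < j)%N -> M i j = 0) -> (forall i, M i i = 1) ->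
  \det M = 1.
Proof.
move=> M0 M1; rewrite det_trig ?big1 //.
by apply/is_trig_mxP => i j; apply: M0.
Qed.

(** A determinant of functionals against a monic basis does not depend on the
    basis, since the change of basis is unitriangular. *)
Lemma det_pairing_monic (R : comNzRingType) N (a : nat -> nat -> R)
    (Q : nat -> {poly R}) :
  (forall k, (k < N)%N -> Q k \is monic /\ size (Q k) = k.+1) ->
  \det (\matrix_(i < N, k < N) pairing (a i) (Q k)) =
  \det (\matrix_(i < N, k < N) a i k).
Proof.
move=> HQ.
have -> : \matrix_(i < N, k < N) pairing (a i) (Q k) =
    (\matrix_(i < N, k < N) a i k) *m (\matrix_(k < N, l < N) (Q k)`_l)^T.
  apply/matrixP => i k; rewrite !mxE (@pairing_wide _ _ _ N); last first.
    by have [_ ->] := HQ k (ltn_ord k).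
  by apply: eq_bigr => l _; rewrite !mxE mulrC.
rewrite det_mulmx det_tr [X in _ * X]det_unitrig ?mulr1 // => i.
  by move=> j lt_ij; rewrite mxE nth_default //; have [_ ->] := HQ i (ltn_ord i).
have [/monicP mi si] := HQ i (ltn_ord i).
by rewrite mxE -mi lead_coefE si.
Qed.

(** If the last [n] rows of a matrix start with a lower unitriangular block and
    vanish to the right of it, Laplace expansion along these rows leaves the
    first [m] rows and the last [m] columns.  Each expansion step removes the
    entry at row [m], column 0, hence the sign. *)
Lemma det_unitrig_below (R : comNzRingType) m n (g T : nat -> nat -> R) :
  (forall i k, (i < k)%N -> T i k = 0) -> (forall i, T i i = 1) ->
  \det (\matrix_(i < m + n, k < m + n) if (i < m)%N then g i k else T (i - m)%N k)
  = (-1) ^+ (m * n) * \det (\matrix_(i < m, k < m) g i (n + k)%N).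
Proof.
elim: n g T => [|n IH] g T T0 T1.
  rewrite muln0 mul1r addn0; congr (\det _); apply/matrixP => i k.
  by rewrite !mxE ltn_ord.
rewrite addnS; have lt_m : (m < (m + n).+1)%N by rewrite ltnS leq_addr.
rewrite (expand_det_row _ (Ordinal lt_m)) (bigD1 ord0) //= big1 ?addr0; last first.
  move=> k k0; rewrite !mxE /= ltnn subnn T0 ?mul0r //.
  by rewrite lt0n; apply: contraNneq k0 => k0; apply/eqP/val_inj.
rewrite mxE /= ltnn subnn T1 mul1r /cofactor /= addn0.
transitivity ((-1) ^+ m * \det (\matrix_(i < m + n, k < m + n)
    if (i < m)%N then g i k.+1 else T (i - m).+1%N k.+1)).
  congr (_ * \det _); apply/matrixP => i k; rewrite !mxE /= /bump /=.
  case: (ltnP i m) => [lt_im | le_mi].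
    by rewrite add0n lt_im add1n.
  by rewrite !add1n ltnNge (leq_trans le_mi) // subSn.
rewrite (IH (fun i k => g i k.+1) (fun i k => T i.+1 k.+1)) //; last first.
  by move=> i k lt_ik; rewrite T0.
by rewrite mulrA -exprD mulnS.
Qed.

(** [hankel t w n] is the Hankel determinant of order [n] of the Motzkin
    functional at [t] multiplied by the polynomial [w]. *)
Definition hankel (R : comNzRingType) (t : R) (w : {poly R}) (n : nat) : R :=
  \det (\matrix_(i < n, j < n) pairing (moment t) ('X^(i + j) * w)).

Lemma hankel_map (R S : comNzRingType) (f : {rmorphism R -> S}) t w n :
  f (hankel t w n) = hankel (f t) (map_poly f w) n.
Proof.
rewrite -det_map_mx; congr (\det _); apply/matrixP => i j; rewrite !mxE.
rewrite pairing_map rmorphM /= map_polyXn /pairing.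
by apply: eq_bigr => l _; rewrite /moment path_weight_map.
Qed.

Lemma hankelZ (R : comNzRingType) (t : R) c w n :
  hankel t (c *: w) n = c ^+ n * hankel t w n.
Proof.
rewrite -detZ; congr (\det _); apply/matrixP => i j.
by rewrite !mxE -scalerAr linearZ.
Qed.

Lemma hankel_detE m n : hankel_det m n = hankel 'X 'X^m n.
Proof.
congr (\det _); apply/matrixP => i j; rewrite !mxE -exprD pairingXn.
by rewrite motzkin_path_weight [(i + j + m)%N]addnC addnA.
Qed.

(** Christoffel's formula.  Both sides compute the determinant, of order
    [m + n], of evaluation at the points [z i] together with integration
    against ['X^0], ..., ['X^n.-1]: once in the basis of powers ['X^k], [k < m],
    followed by the multiples ['X^k * w], once in the basis of orthogonal
    polynomials. *)
Lemma christoffel (R : comNzRingType) (t : R) m n (z : nat -> R) :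
  let w : {poly R} := \prod_(i < m) ('X - (z i)%:P) in
  \det (\matrix_(i < m, k < m) z i ^+ k) * hankel t w n =
  (-1) ^+ (m * n) * \det (\matrix_(i < m, k < m) (orth t (n + k)).[z i]).
Proof.
move=> w.
pose a i l := if (i < m)%N then z i ^+ l else moment t (i - m + l)%N.
pose Q k : {poly R} := if (k < m)%N then 'X^k else 'X^(k - m) * w.
have w_monic : w \is monic by apply: monic_prod_XsubC.
have size_w : size w = m.+1 by rewrite size_prod_XsubC /index_enum -enumT size_enum_ord.
transitivity (\det (\matrix_(i < m + n, k < m + n) pairing (a i) (Q k))).
  rewrite /hankel -(det_lblock _
    (\matrix_(i < n, k < m) pairing (a (m + i)%N) (Q k))).
  congr (\det _); apply/matrixP => i k; rewrite [RHS]mxE /a /Q.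
  case: (split_ordP i) => [i1 ->|i1 ->]; case: (split_ordP k) => [k1 ->|k1 ->];
    rewrite ?block_mxEul ?block_mxEur ?block_mxEdl ?block_mxEdr !mxE /=;
    rewrite ?ltn_ord ?ltnNge ?leq_addr //=.
  - by rewrite pairing_horner hornerXn.
  - rewrite pairing_horner hornerM /w horner_prod (bigD1 i1) //= !hornerE.
    by rewrite /= subrr mulr0 mul0r.
  - by rewrite !addKn exprD -mulrA pairing_mulXn.
transitivity (\det (\matrix_(i < m + n, k < m + n) pairing (a i) (orth t k))).
  rewrite !det_pairing_monic // => k _; first exact: orth_monic_size.
  rewrite /Q; case: (ltnP k m) => [_|le_mk].
    by rewrite monicXn size_polyXn.
  split; first by rewrite monicMl ?monicXn.
  by rewrite size_monicM ?monicXn ?monic_neq0 // size_polyXn size_w addnS addSn /= subnK.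
rewrite -(@det_unitrig_below _ _ _ (fun i k => (orth t k).[z i]) (path_weight t)).
- congr (\det _); apply/matrixP => i k; rewrite !mxE /a.
  by case: ltnP => _; rewrite ?pairing_horner ?pairing_orth.
- exact: path_weight_small.
- exact: path_weight_diag.
Qed.
(** * Exponential sums and their denominators *)

(** The polynomial in ['X] whose reciprocal roots are the subset products
    [\prod_(i in S) r i]. *)
Definition subset_denominator (R : comNzRingType) m (r : 'I_m -> R) : {poly R} :=
  \prod_(S : {set 'I_m}) (1 - (\prod_(i in S) r i)%:P * 'X).

Lemma subset_denominator_map (R S : comNzRingType) (f : {rmorphism R -> S}) m
    (r : 'I_m -> R) :
  map_poly f (subset_denominator r) = subset_denominator (f \o r).
Proof.
rewrite /subset_denominator rmorph_prod; apply: eq_bigr => J _.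
by rewrite rmorphB rmorph1 rmorphM /= map_polyX map_polyC /= rmorph_prod.
Qed.

Lemma size_subset_denominator (R : idomainType) m (r : 'I_m -> R) :
  (size (subset_denominator r) <= (2 ^ m).+1)%N.
Proof.
apply: leq_trans (size_poly_prod_leq _ _) _.
have card_sets : #|{: {set 'I_m}}| = (2 ^ m)%N.
  by rewrite -cardsT -powersetT card_powerset cardsT card_ord.
rewrite card_sets leq_subLR.
apply: (@leq_trans (\sum_(J : {set 'I_m}) 2).+1).
  rewrite ltnS leq_sum // => J _.
  rewrite (leq_trans (size_polyD _ _)) // geq_max size_poly1 /= size_polyN.
  by rewrite mul_polyC (leq_trans (size_scale_leq _ _)) ?size_polyX.
by rewrite sum_nat_const card_sets muln2 -addnn addnS.
Qed.

(** The left-hand side is [r ^+ n * f.[r^-1]]. *)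
Lemma fps_mul_geometric (F : fieldType) (f : {poly F}) r n :
  r != 0 -> f.[r^-1] = 0 -> (size f <= n.+1)%N ->
  fps_mul (fps_poly f) (fun l => r ^+ l) n = 0.
Proof.
move=> r0 f0 le_fn; transitivity (r ^+ n * f.[r^-1]); last by rewrite f0 mulr0.
rewrite (horner_coef_wide _ le_fn) mulr_sumr; apply: eq_bigr => l _.
by rewrite mulrCA exprVn -expfB_cond // (negPf r0) add0n leq_ord.
Qed.

(** Expanding the determinant over permutations and then over the set of rows
    contributing their exponential term. *)
Lemma det_exponential (R : comNzRingType) m (r : 'I_m -> R)
    (alpha beta : 'I_m -> 'I_m -> R) :
  exists c : {set 'I_m} -> R, forall n,
    \det (\matrix_(i, k) (alpha i k * r i ^+ n + beta i k)) =
    \sum_S c S * (\prod_(i in S) r i) ^+ n.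
Proof.
exists (fun S : {set 'I_m} => \sum_(s : 'S_m) (-1) ^+ s *
                   \prod_i (if i \in S then alpha i (s i) else beta i (s i))).
move=> n; under [RHS]eq_bigr do rewrite mulr_suml.
rewrite exchange_big; apply: eq_bigr => s _ /=.
under eq_bigr do rewrite mxE.
rewrite bigA_distr big_distrr /=; apply: eq_bigr => S _.
rewrite -mulrA; congr (_ * _).
rewrite -prodrXl [X in _ = _ * X]big_mkcond -big_split /=.
by apply: eq_bigr => i _; case: ifP; rewrite ?mulr1.
Qed.

Lemma fps_mul_exponential_sum (F : fieldType) m (r : 'I_m -> F)
    (c : {set 'I_m} -> F) (g : nat -> F) n :
  (forall i, r i != 0) -> (2 ^ m <= n)%N ->
  (forall k, g k = \sum_S c S * (\prod_(i in S) r i) ^+ k) ->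
  fps_mul (fps_poly (subset_denominator r)) g n = 0.
Proof.
move=> r0 le_n gE; rewrite /fps_mul.
under eq_bigr do rewrite gE mulr_sumr.
rewrite exchange_big big1 //= => S _.
under eq_bigr do rewrite mulrCA.
rewrite -mulr_sumr; set p := \prod_(i in S) r i.
have p0 : p != 0 by apply/prodf_neq0 => i _.
rewrite [X in _ * X]fps_mul_geometric ?mulr0 //; last first.
  exact: leq_trans (size_subset_denominator r) _.
rewrite /subset_denominator horner_prod (bigD1 S) //= !hornerE -/p.
by rewrite mulfV // subrr mul0r.
Qed.

(** At the point [t - q - q^-1] the [n]-th orthogonal polynomial is, up to the
    factor [(- q) ^+ n * (q ^+ 2 - 1)], a difference of two exponentials in [n]. *)
Lemma orth_horner (F : fieldType) (t q : F) n : q != 0 ->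
  (- q) ^+ n * (orth t n).[t - q - q^-1] * (q ^+ 2 - 1) = (q ^+ 2) ^+ n.+1 - 1.
Proof.
move=> q0; elim/two_step_ind: n => [||n IH IH1].
- by rewrite !hornerE.
- by rewrite /= !hornerE; field.
have -> : (- q) ^+ n.+2 * (orth t n.+2).[t - q - q^-1] * (q ^+ 2 - 1) =
   (q ^+ 2 + 1) * ((- q) ^+ n.+1 * (orth t n.+1).[t - q - q^-1] * (q ^+ 2 - 1))
   - q ^+ 2 * ((- q) ^+ n * (orth t n).[t - q - q^-1] * (q ^+ 2 - 1)).
  rewrite [orth t n.+2]/= hornerD hornerN hornerM hornerXsubC.
  move: (_.[_]) (_.[_]) => u v; rewrite !exprS; by field.
by rewrite IH IH1 !exprS; ring.
Qed.

Lemma det_vandermonde_neq0 (F : fieldType) m (z : nat -> F) :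
  (forall i j, (i < j < m)%N -> z i != z j) ->
  \det (\matrix_(i < m, k < m) z i ^+ k) != 0.
Proof.
move=> zinj; rewrite -det_tr.
have -> : (\matrix_(i < m, k < m) z i ^+ k)^T =
          Vandermonde m (\row_(i < m) z i).
  by apply/matrixP => i j; rewrite !mxE.
rewrite det_Vandermonde; apply/prodf_neq0 => i _; apply/prodf_neq0 => j lt_ij.
by rewrite !mxE subr_eq0 eq_sym zinj // lt_ij ltn_ord.
Qed.

(** * The recurrence at distinct points *)

Lemma add_inv_inj (F : realFieldType) (q r : F) :
  1 < q -> 1 < r -> q + q^-1 = r + r^-1 -> q = r.
Proof.
move=> q1 r1 eq_qr.
have q0 : q != 0 by rewrite gt_eqF // (lt_trans _ q1).
have r0 : r != 0 by rewrite gt_eqF // (lt_trans _ r1).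
have : (q - r) * (q * r - 1) == 0.
  have -> : (q - r) * (q * r - 1) = (q + q^-1 - (r + r^-1)) * (q * r).
    by field; rewrite q0 r0.
  by rewrite eq_qr subrr mul0r.
by rewrite mulf_eq0 !subr_eq0 [_ * _ == 1]gt_eqF ?mulr_egt1 // orbF => /eqP.
Qed.

(** The product of the [q i *: ('X - (t - q i - (q i)^-1)%:P)], written without
    denominators so that its coefficients are polynomials in the [q i]. *)
Definition cleared_weight (R : nzRingType) (t : R) m (q : nat -> R) : {poly R} :=
  \prod_(i < m) ((q i)%:P * 'X - (t * q i - q i ^+ 2 - 1)%:P).

Lemma cleared_weight_map (R S : comNzRingType) (f : {rmorphism R -> S}) t m q :
  map_poly f (cleared_weight t m q) = cleared_weight (f t) m (f \o q).
Proof.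
rewrite /cleared_weight rmorph_prod; apply: eq_bigr => J _.
rewrite rmorphB rmorphM /= map_polyX !map_polyC /=.
by rewrite !(rmorphB, rmorphM, rmorphXn, rmorph1).
Qed.

Lemma fps_mul_hankel_distinct (F : realFieldType) (t : F) m (q : nat -> F) n :
  injective q -> (forall i, 1 < q i) -> (2 ^ m <= n)%N ->
  fps_mul (fps_poly (subset_denominator (fun i : 'I_m => q i ^+ 2)))
       (hankel t (cleared_weight t m q)) n = 0.
Proof.
move=> qinj q1 le_n.
have q_gt0 i : 0 < q i by apply: lt_trans (q1 i).
have q0 i : q i != 0 by rewrite gt_eqF.
have q21 i : q i ^+ 2 - 1 != 0 by rewrite subr_eq0 gt_eqF // exprn_egt1.
pose z i := t - q i - (q i)^-1.
pose V := \det (\matrix_(i < m, k < m) z i ^+ k).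
have V0 : V != 0.
  apply: det_vandermonde_neq0 => i j /andP[lt_ij _].
  apply: contraTneq lt_ij; rewrite /z -!addrA -!opprD => /addrI/oppr_inj.
  by move/(add_inv_inj (q1 i) (q1 j))/qinj ->; rewrite ltnn.
have wE : cleared_weight t m q =
    (\prod_(i < m) q i) *: \prod_(i < m) ('X - (z i)%:P).
  rewrite -mul_polyC rmorph_prod -big_split; apply: eq_bigr => i _ /=.
  rewrite mulrBr -rmorphM; congr (_ - _%:P); rewrite /z; by field.
pose alpha (i k : 'I_m) := (- q i) ^- k * q i ^+ 2 ^+ k.+1 / (q i ^+ 2 - 1).
pose beta (i k : 'I_m) := - ((- q i) ^- k / (q i ^+ 2 - 1)).
have [c cE] := det_exponential (fun i : 'I_m => q i ^+ 2) alpha beta.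
apply: (@fps_mul_exponential_sum _ _ _ (fun S => V^-1 * c S)) => // [i|k].
  by rewrite expf_neq0.
under eq_bigr do rewrite -mulrA.
rewrite -mulr_sumr -cE wE hankelZ.
apply: (mulfI V0); rewrite mulVKf // mulrCA christoffel.
have -> : \matrix_(i, j) (alpha i j * (q i ^+ 2) ^+ k + beta i j) =
    diag_mx (\row_(i < m) (- q i) ^+ k)
    *m (\matrix_(i < m, j < m) (orth t (k + j)).[z i]).
  apply/matrixP => i j; rewrite mul_diag_mx !mxE.
  have qj0 : (- q i) ^+ j != 0 by rewrite expf_neq0 ?oppr_eq0.
  apply: (mulIf (q21 i)); apply: (mulfI qj0).
  rewrite !mulrA -exprD [(j + k)%N]addnC orth_horner //.
  rewrite /alpha /beta -addnS exprD; move: qj0 (q21 i).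
  move: ((- q i) ^+ j) ((q i ^+ 2) ^+ k) ((q i ^+ 2) ^+ j.+1) (q i ^+ 2) => u v w y u0 y0.
  by field; rewrite u0 y0.
rewrite det_mulmx det_diag mulrA; congr (_ * _).
have -> : (-1) ^+ (m * k) = \prod_(i < m) (-1) ^+ k :> F.
  by rewrite prodr_const card_ord -exprM mulnC.
rewrite -prodrXl -big_split; apply: eq_bigr => i _ /=.
by rewrite mxE -exprMn mulrN1.
Qed.
(** * Confluence of the points *)

Lemma poly_eq0_injective (F : idomainType) (p : {poly F}) (x : nat -> F) :
  injective x -> (forall k, p.[x k] = 0) -> p = 0.
Proof.
move=> xinj px; apply: (@roots_geq_poly_eq0 _ p (mkseq x (size p))).
- by apply/allP => _ /mapP[k _ ->]; apply/rootP.
- exact: mkseq_uniq.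
- by rewrite size_mkseq.
Qed.

Lemma rmorph_fps_mul (R S : nzRingType) (f : {rmorphism R -> S}) g h n :
  f (fps_mul g h n) = fps_mul (f \o g) (f \o h) n.
Proof. by rewrite rmorph_sum; apply: eq_bigr => l _; rewrite rmorphM. Qed.

Lemma eq_fps_mul (R : nzRingType) (f f' g g' : fps R) :
  f =1 f' -> g =1 g' -> fps_mul f g =1 fps_mul f' g'.
Proof. by move=> ff gg n; apply: eq_bigr => l _; rewrite ff gg. Qed.

Lemma eq_subset_denominator (R : comNzRingType) m (r r' : 'I_m -> R) :
  r =1 r' -> subset_denominator r = subset_denominator r'.
Proof.
move=> rr'; apply: eq_bigr => S _; congr (1 - _%:P * _).
by apply: eq_bigr => i _.
Qed.

Lemma eq_cleared_weight (R : nzRingType) (t : R) m (q q' : nat -> R) :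
  q =1 q' -> cleared_weight t m q = cleared_weight t m q'.
Proof. by move=> qq'; apply: eq_bigr => i _; rewrite qq'. Qed.

(** The recurrence persists when all points coincide: for the points given by
    [q + e *+ i] it is a polynomial identity in [e], valid at all positive
    integers [e], hence at [e = 0]. *)
Lemma fps_mul_hankel_confluent (F : realFieldType) (t q : F) m n :
  1 < q -> (2 ^ m <= n)%N ->
  fps_mul (fps_poly (subset_denominator (fun _ : 'I_m => q ^+ 2)))
    (hankel t (cleared_weight t m (fun=> q))) n = 0.
Proof.
move=> q1 le_n.
pose Q i : {poly F} := q%:P + 'X *+ i.
pose P := fps_mul (fps_poly (subset_denominator (fun i : 'I_m => Q i ^+ 2)))
  (hankel t%:P (cleared_weight t%:P m Q)) n.
have PE e : P.[e] =
    fps_mul (fps_poly (subset_denominator (fun i : 'I_m => (q + e *+ i) ^+ 2)))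
      (hankel t (cleared_weight t m (fun i => q + e *+ i))) n.
  have QE i : horner_eval e (Q i) = q + e *+ i.
    by rewrite /horner_eval /Q !hornerE hornerMn hornerX.
  rewrite -[P.[e]]/(horner_eval e P) rmorph_fps_mul.
  apply: eq_fps_mul => l /=.
    rewrite /fps_poly -coef_map subset_denominator_map; congr ((polyseq _)`_l).
    by apply: eq_subset_denominator => i; rewrite /= rmorphXn /= QE.
  rewrite hankel_map cleared_weight_map /= [horner_eval e t%:P]hornerC.
  by congr (hankel _ _ _); apply: eq_cleared_weight => i; rewrite /= QE.
have P0 : P = 0.
  apply: (@poly_eq0_injective _ P (fun k => k.+1%:R)) => [k l /eqP|k].
    by rewrite eqr_nat => /eqP[].
  rewrite PE; apply: fps_mul_hankel_distinct => // [i j|i].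
    move=> /addrI /eqP; rewrite -!mulrnA eqr_nat eqn_mul2l /=.
    by move/eqP.
  by rewrite ltr_wpDr // mulrn_wge0.
have := PE 0; rewrite P0 horner0 => ->; apply: eq_fps_mul => l.
  rewrite /fps_poly; congr ((polyseq _)`_l); apply: eq_subset_denominator => i.
  by rewrite mul0rn addr0.
by congr (hankel _ _ _); apply: eq_cleared_weight => i; rewrite mul0rn addr0.
Qed.

(** * Identification of the denominator *)

(** For constant [r] the subsets of equal size give equal factors. *)
Lemma subset_denominator_const (R : comNzRingType) m (r : R) :
  subset_denominator (fun _ : 'I_m => r) =
  \prod_(0 <= j < m.+1) (1 - (r ^+ j)%:P * 'X) ^+ 'C(m, j).
Proof.
rewrite /subset_denominator.
have le_card (S : {set 'I_m}) : (#|S| < m.+1)%N.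
  by rewrite ltnS -[m in (_ <= m)%N]card_ord max_card.
rewrite (partition_big (fun S => Ordinal (le_card S)) predT) //= big_mkord.
apply: eq_bigr => j _.
rewrite (eq_bigr (fun=> 1 - (r ^+ j)%:P * 'X)); last first.
  by move=> S /eqP <-; rewrite prodr_const.
rewrite prodr_const; congr (_ ^+ _).
rewrite -[m in 'C(m, _)]card_ord -card_draws; apply: eq_card => S.
by rewrite [RHS]inE.
Qed.

Lemma coef_comp_scaleX (R : comNzRingType) (p : {poly R}) c l :
  (p \Po (c *: 'X))`_l = p`_l * c ^+ l.
Proof.
have [lt_l|le_l] := ltnP l (size p); last first.
  rewrite [p`_l]nth_default // mul0r coef_comp_poly big1 // => i _.
  by rewrite exprZn coefZ coefXn gtn_eqF ?mulr0 // (leq_trans (ltn_ord i)).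
rewrite coef_comp_poly (bigD1 (Ordinal lt_l)) //= big1 ?addr0.
  by rewrite exprZn coefZ coefXn eqxx mulr1.
move=> i neq_il; rewrite exprZn coefZ coefXn -[_ == _]/(Ordinal lt_l == i).
by rewrite eq_sym (negPf neq_il) !mulr0.
Qed.

(** Pairing the indices [j] and [m - j]; the middle index of an even [m] stays
    alone. *)
Lemma big_nat_fold (R : comNzRingType) m (H : nat -> R) :
  \prod_(0 <= j < m.+1) H j =
  \prod_(0 <= j < m./2.+1) (if (m - 2 * j == 0)%N then H j else H j * H (m - j)%N).
Proof.
elim/two_step_ind: m H => [||m IH _] H.
- by rewrite !big_nat1.
- by rewrite /= big_nat1 unlock /= mulr1.
rewrite big_nat_recl // big_nat_recr //= IH [RHS]big_nat_recl // mulrA mulrAC.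
congr (_ * _); apply: eq_big_nat => j /andP[_ lt_j].
rewrite mulnS subSS; congr (if _ then _ else _ * H _).
by rewrite subSn // (leq_trans (ltnSE lt_j)) // -divn2 leq_div.
Qed.
(** Evaluation of a polynomial in [t] at [t = q + q^-1]. *)
Definition laurent_eval (F : fieldType) (q : F) : {poly int} -> F :=
  horner_eval (q + q^-1) \o map_poly intr.

HB.instance Definition _ (F : fieldType) (q : F) :=
  GRing.RMorphism.copy (laurent_eval q) (horner_eval (q + q^-1) \o map_poly intr).

Lemma laurent_evalX (F : fieldType) (q : F) : laurent_eval q 'X = q + q^-1.
Proof. by rewrite /laurent_eval /= map_polyX /horner_eval hornerX. Qed.

Lemma laurent_eval_lucas (F : fieldType) (q : F) n : q != 0 ->
  laurent_eval q (lucas n) = q ^+ n + q ^- n.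
Proof.
move=> q0; elim/two_step_ind: n => [||n IH IH1].
- by rewrite rmorph_nat invr1.
- exact: laurent_evalX.
rewrite [lucas n.+2]/= rmorphB rmorphM /= laurent_evalX IH IH1 !exprS.
have qn0 : q ^+ n != 0 by rewrite expf_neq0.
by move: (q ^+ n) qn0 => u u0; field; rewrite u0.
Qed.

(** At [t = q + q^-1] the polynomial [A n], [0 < n], splits into
    [(1 - q ^+ n x) (1 - q ^- n x)]. *)
Lemma map_denominator (F : fieldType) (q : F) m : q != 0 ->
  map_poly (laurent_eval q) (\prod_(0 <= j < m./2.+1) A (m - 2 * j) ^+ 'C(m, j))
  = subset_denominator (fun _ : 'I_m => q ^+ 2) \Po (q ^- m *: 'X).
Proof.
move=> q0; rewrite subset_denominator_const.
pose h k : {poly F} := 1 - (q ^+ 2 ^+ k * q ^- m)%:P * 'X.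
have -> : (\prod_(0 <= j < m.+1) (1 - (q ^+ 2 ^+ j)%:P * 'X) ^+ 'C(m, j))
    \Po (q ^- m *: 'X) = \prod_(0 <= j < m.+1) h j ^+ 'C(m, j).
  rewrite rmorph_prod; apply: eq_bigr => j _; rewrite rmorphXn; congr (_ ^+ _).
  rewrite /= comp_polyB comp_polyC comp_polyM comp_polyC comp_polyX.
  by rewrite -mul_polyC mulrA -rmorphM.
rewrite [RHS]big_nat_fold rmorph_prod; apply: eq_big_nat => j /andP[_ lt_j].
have le_j : (2 * j <= m)%N.
  by rewrite mul2n -[m]odd_double_half (leq_trans _ (leq_addl _ _)) // leq_double.
have le_jm : (j <= m)%N by apply: leq_trans le_j; rewrite leq_pmull.
rewrite rmorphXn /= bin_sub // -exprMn.
rewrite /A; set n := (m - 2 * j)%N.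
have qmE : q ^+ m = q ^+ n * q ^+ 2 ^+ j by rewrite -exprM -exprD subnK.
have qj0 : q ^+ 2 ^+ j != 0 by rewrite !expf_neq0.
case: eqP => [n0|_].
  rewrite /h qmE n0 mul1r mulfV // mul1r.
  by rewrite rmorphB rmorph1 /= map_polyX.
have qn0 : q ^+ n != 0 by rewrite expf_neq0.
have hE : h j = 1 - (q ^- n)%:P * 'X.
  by rewrite /h qmE; congr (1 - _%:P * _); field; rewrite qn0.
have hE' : h (m - j)%N = 1 - (q ^+ n)%:P * 'X.
  rewrite /h; congr (1 - _%:P * _); apply: (mulIf (expf_neq0 m q0)).
  by rewrite mulfVK ?expf_neq0 // -exprM -exprD; congr (_ ^+ _); lia.
rewrite hE hE' rmorphD rmorphB rmorph1 /= map_polyXn.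
rewrite [map_poly _ (_ * 'X)]rmorphM /= map_polyX map_polyC /=.
rewrite laurent_eval_lucas // polyCD; congr (_ ^+ _).
have : (q ^- n)%:P * (q ^+ n)%:P = 1 :> {poly F} by rewrite -rmorphM mulVf.
move: (q ^- n)%:P (q ^+ n)%:P => u v uv.
transitivity ((u * v) * 'X^2 - (v + u) * 'X + 1); first by rewrite uv mul1r.
by ring.
Qed.

(** * The rational generating function *)

Lemma hankel_det_recurrence m n : (2 ^ m <= n)%N ->
  fps_mul (fps_poly (\prod_(0 <= j < m./2.+1) A (m - 2 * j) ^+ 'C(m, j)))
    (hankel_gf m) n = 0.
Proof.
move=> le_n; set D := \prod_(_ <= _ < _) _; set d := fps_mul _ _ _.
(* Since [q + q^-1] is injective on [1 < q], these values give infinitely many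
   evaluation points for [t]. *)
pose q k : rat := k.+2%:R.
have q1 k : 1 < q k by rewrite ltr1n.
have q0 k : q k != 0 by rewrite gt_eqF // (lt_trans _ (q1 k)).
suff ev0 k : laurent_eval (q k) d = 0.
  apply: (@map_inj_poly _ _ (intr : int -> rat) (@intr_inj _)) => //.
  rewrite rmorph0.
  apply: (@poly_eq0_injective _ _ (fun k => q k + (q k)^-1)) => // k l.
  by move/(add_inv_inj (q1 k) (q1 l)) => /eqP; rewrite eqr_nat => /eqP[].
have hankelE i : hankel (q k + (q k)^-1)
      (cleared_weight (q k + (q k)^-1) m (fun=> q k)) i =
    q k ^+ m ^+ i * laurent_eval (q k) (hankel_det m i).
  rewrite hankel_detE hankel_map /= map_polyXn laurent_evalX -hankelZ.
  congr (hankel _ _ _).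
  rewrite -exprZn -[m in RHS]card_ord -prodr_const; apply: eq_bigr => j _.
  rewrite (_ : _ - _ = 0 :> rat) ?subr0 ?mul_polyC //.
  by rewrite mulrDl mulVf // -expr2 [_ - q k ^+ 2]addrAC subrr add0r subrr.
(* The factor [q ^+ (m * n)] turns the denominator in [x / q ^+ m] and the
   determinants [d_m] into the data of the confluent recurrence. *)
have qm0 : q k ^+ m ^+ n != 0 by rewrite !expf_neq0.
apply: (mulfI qm0); rewrite mulr0.
rewrite -[RHS](@fps_mul_hankel_confluent _ (q k + (q k)^-1) (q k) m n (q1 k) le_n).
rewrite rmorph_fps_mul mulr_sumr; apply: eq_bigr => l _.
rewrite /fps_poly /= -coef_map map_denominator // coef_comp_scaleX hankelE.
have -> : q k ^+ m ^+ n = q k ^+ m ^+ l * q k ^+ m ^+ (n - l).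
  by rewrite -exprD subnKC // leq_ord.
rewrite exprVn; have : q k ^+ m ^+ l != 0 by rewrite !expf_neq0.
by move: (_ ^+ l) => u u0; rewrite /hankel_gf; field.
Qed.

Lemma fps_mulA (R : comNzRingType) (f g h : fps R) :
  fps_mul f (fps_mul g h) =1 fps_mul (fps_mul f g) h.
Proof.
move=> n; pose T (u : fps R) := \poly_(i < n.+1) u i.
have TE u i : (i <= n)%N -> (T u)`_i = u i by rewrite coef_poly ltnS => ->.
have TM u v i : (i <= n)%N -> (T u * T v)`_i = fps_mul u v i.
  move=> le_in; rewrite coefM; apply: eq_bigr => j _.
  by rewrite !TE ?(leq_trans (leq_subr _ _)) // (leq_trans (leq_ord j)).
transitivity ((T f * (T g * T h))`_n).
  rewrite coefM; apply: eq_bigr => i _.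
  by rewrite TE ?leq_ord // TM // leq_subr.
rewrite mulrA coefM; apply: eq_bigr => i _.
by rewrite TM ?leq_ord // TE // leq_subr.
Qed.

Lemma fps_mulC (R : comNzRingType) (f g : fps R) : fps_mul f g =1 fps_mul g f.
Proof.
move=> n; rewrite /fps_mul (reindex_inj rev_ord_inj) /=.
by apply: eq_bigr => i _; rewrite subSS subKn ?leq_ord // mulrC.
Qed.

Lemma fps_mul1 (R : nzRingType) (f : fps R) : fps_mul f (fps_poly 1) =1 f.
Proof.
move=> n; rewrite /fps_mul /fps_poly big_ord_recr /= subnn coef1 mulr1.
rewrite big1 ?add0r // => i _.
by rewrite coef1 subn_eq0 leqNgt ltn_ord mulr0.
Qed.

Lemma fps_div_rational (R : comUnitRingType) (D : {poly R}) (f : fps R) N :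
  D`_0 \is a GRing.unit -> (forall n, (N <= n)%N -> fps_mul (fps_poly D) f n = 0) ->
  exists P : {poly R}, f =1 fps_div (fps_poly P) (fps_poly D).
Proof.
move=> D0 Df0; exists (\poly_(i < N) fps_mul (fps_poly D) f i) => n.
have numE : fps_poly (\poly_(i < N) fps_mul (fps_poly D) f i) =1
            fps_mul f (fps_poly D).
  by move=> i; rewrite fps_mulC /fps_poly coef_poly; case: ltnP => // /Df0.
rewrite /fps_div (eq_fps_mul numE (fun=> erefl)) -fps_mulA.
by rewrite (eq_fps_mul (fun=> erefl) (fps_mulfV D0)) fps_mul1.
Qed.

Theorem theorem1p1 (m : nat) (hm : (0 < m)%N) :
  exists R : {poly {poly int}},
    hankel_gf m =1 fps_div (fps_poly R)
      (fps_poly (\prod_(0 <= j < m./2.+1) A (m - 2 * j) ^+ 'C(m, j))).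
Proof.
apply: (@fps_div_rational _ _ _ (2 ^ m)%N).
  by rewrite denominator_coef0 unitr1.
exact: hankel_det_recurrence.
Qed.
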